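(* There is a high-above ideal that contains no almost everywhere dominating set.
   Context: An ideal is a nonempty set $\mathcal{I}\subseteq 2^\omega$ such that if $X\in\mathcal{I}$ and $Y\leq_T X$ then $Y\in\mathcal{I}$, and if $X,Y\in\mathcal{I}$ then $X\oplus Y\in\mathcal{I}$. An ideal $\mathcal{I}$ is a high-above ideal if for every $A\in\mathcal{I}$ there is $B\in\mathcal{I}$ with $A<_T B$ and $A''\leq_T B'$. $\mu$ is the fair-coin (Lebesgue) probability measure on $2^\omega$; ''almost all'' means on a set of $\mu$-measure $1$. For $f,g\in\omega^\omega$, $f$ dominates $g$ if $\exists m\,\forall n>m\,(f(n)>g(n))$. A set $A$ is almost everywhere (a.e.) dominating if for almost all $X\in 2^\omega$ and all functions $g\leq_T X$, there is a function $f\leq_T A$ such that $f$ dominates $g$. *)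

(* Defs.v *)
From HB Require Import structures.
From Stdlib Require Cantor.
From mathcomp Require Import all_boot all_order all_algebra.
From mathcomp Require Import zify.
From mathcomp Require Import all_classical all_reals all_analysis.
Set Implicit Arguments.
Unset Strict Implicit.
Unset Printing Implicit Defensive.
Import Order.TTheory GRing.Theory Num.Theory.
Import numFieldNormedType.Exports.
Local Open Scope classical_set_scope.

Definition npair (a b : nat) : nat := Cantor.to_nat (a, b).
Definition nfst (n : nat) : nat := (Cantor.of_nat n).1.
Definition nsnd (n : nat) : nat := (Cantor.of_nat n).2.

Inductive code : Type :=
| CZero | CSucc | CFst | CSnd | COracle
| CPair of code & code
| CComp of code & code
| CPrec of code & code
| CMu of code.

(** [eval A c n m]: the partial [A]-recursive function with code [c] is defined
    at [n] and has value [m].  All functions are unary; several arguments are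
    passed through the Cantor pairing.  [CPrec f g] is the function [h] with
    [h <a, 0> = f a] and [h <a, k + 1> = g <a, <k, h <a, k>>>]; [CMu f] maps [n]
    to the least [m] with [f <n, m> = 0], provided that [f <n, k>] is defined
    for all [k < m]. *)
Fixpoint eval (A : nat -> bool) (c : code) (n m : nat) {struct c} : Prop :=
  match c with
  | CZero => m = 0
  | CSucc => m = n.+1
  | CFst => m = nfst n
  | CSnd => m = nsnd n
  | COracle => m = A n
  | CPair f g => exists a b, [/\ eval A f n a, eval A g n b & m = npair a b]
  | CComp f g => exists2 k, eval A g n k & eval A f k m
  | CPrec f g =>
      (fix prec (k r : nat) {struct k} : Prop :=
         if k is k'.+1 then
           exists2 r', prec k' r' & eval A g (npair (nfst n) (npair k' r')) r
         else eval A f (nfst n) r) (nsnd n) m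
  | CMu f => eval A f (npair n m) 0 /\
             forall k, k < m -> exists v, eval A f (npair n k) v.+1
  end.

(** A bijective Gödel numbering of the codes, see [index_bij]. *)
Fixpoint index (c : code) : nat :=
  match c with
  | CZero => 0 | CSucc => 1 | CFst => 2 | CSnd => 3 | COracle => 4
  | CPair f g => 4 * npair (index f) (index g) + 5
  | CComp f g => 4 * npair (index f) (index g) + 6
  | CPrec f g => 4 * npair (index f) (index g) + 7
  | CMu f => 4 * index f + 8
  end.

(** The graph of the [e]-th partial [A]-recursive function. *)
Definition phi (A : nat -> bool) (e n m : nat) : Prop :=
  exists2 c, index c = e & eval A c n m.

Definition computable_in (A : nat -> bool) (g : nat -> nat) : Prop :=
  exists e, forall n, phi A e n (g n).

(** [Tle A B] is A <=_T B, and [Tlt A B] is A <_T B. *)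
Definition Tle (A B : nat -> bool) : Prop := computable_in B (fun n => A n : nat).
Definition Tlt (A B : nat -> bool) : Prop := Tle A B /\ ~ Tle B A.

Definition jump (A : nat -> bool) : nat -> bool :=
  fun e => `[< exists m, phi A e e m >].

Definition Tjoin (X Y : nat -> bool) : nat -> bool :=
  fun n => if odd n then Y n./2 else X n./2.

Record is_ideal (I : set (nat -> bool)) : Prop := IsIdeal {
  ideal_nonempty : I !=set0;
  ideal_Tle : forall X Y, I X -> Tle Y X -> I Y;
  ideal_Tjoin : forall X Y, I X -> I Y -> I (Tjoin X Y) }.

Definition high_above_ideal (I : set (nat -> bool)) : Prop :=
  is_ideal I /\
  forall A, I A ->
    exists B, [/\ I B, Tlt A B & Tle (jump (jump A)) (jump B)].

Definition cylinder (s : seq bool) : set (nat -> bool) :=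
  [set X | forall i, i < size s -> X i = nth false s i].

(** Cantor space with its Borel sigma-algebra. *)
Notation cantor := (g_sigma_algebraType (range cylinder)).

(** [binary_digits x] is the binary expansion of [x] in [0, 1[. *)
Definition binary_digits (R : realType) (x : R) : cantor :=
  fun n => odd (Num.truncn (2 ^+ n.+1 * x)%R).

Section binary_digits_measurable.
Variable R : realType.

Lemma measurable_binary_digits :
  measurable_fun [set: measurableTypeR R] (@binary_digits R).
Proof.
apply: (@measurability _ _ (measurableTypeR R) cantor setT _ (range cylinder)) => // _ [_ [s _ <-] <-].
rewrite setTI.
have mgt (c : R) k : (0 < c)%R ->
    measurable [set x : measurableTypeR R | k < Num.truncn (c * x)%R].
  move=> c0; rewrite (_ : [set _ | _] = `[(k.+1%:R / c)%R, +oo[%classic).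
    exact: measurable_itv.
  apply/seteqP; split=> x /=;
    by rewrite in_itv/= andbT truncn_gt_nat ler_pdivrMr// mulrC.
have meq (c : R) k : (0 < c)%R ->
    measurable [set x : measurableTypeR R | Num.truncn (c * x)%R = k].
  move=> c0; case: k => [|k].
    rewrite (_ : [set _ | _] =
      ~` [set x : measurableTypeR R | 0 < Num.truncn (c * x)%R]).
      by apply: measurableC; exact: mgt.
    by apply/seteqP; split=> x /=; lia.
  rewrite (_ : [set _ | _] =
    [set x : measurableTypeR R | k < Num.truncn (c * x)%R] `\`
    [set x : measurableTypeR R | k.+1 < Num.truncn (c * x)%R]).
    by apply: measurableD; exact: mgt.
  by apply/seteqP; split=> x /=; lia.
have modd (c : R) (b : bool) : (0 < c)%R ->
    measurable [set x : measurableTypeR R | odd (Num.truncn (c * x)%R) = b].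
  move=> c0; rewrite (_ : [set _ | _] = \bigcup_(k in [set k | odd k = b])
     [set x : measurableTypeR R | Num.truncn (c * x)%R = k]).
    by apply: bigcup_measurable => k _; exact: meq.
  by apply/seteqP; split=> x /=; [move=> h; exists (Num.truncn (c * x)%R)
    | move=> [k /= hk ->]].
rewrite (_ : _ @^-1` _ = \bigcap_(i in [set i | i < size s])
  [set x : measurableTypeR R |
    odd (Num.truncn (2 ^+ i.+1 * x)%R) = nth false s i]).
  by apply: bigcap_measurableType => i _; apply: modd; rewrite exprn_gt0.
by apply/seteqP; split=> x /= h i hi; exact: h.
Qed.

HB.instance Definition _ := isMeasurableFun.Build _ _ _ _
  (@binary_digits R : measurableTypeR R -> cantor) measurable_binary_digits.

End binary_digits_measurable.

(** The fair-coin measure is the law of the binary digits of a uniformly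
    distributed real number; see [fair_coin_cylinder]. *)
Definition fair_coin (R : realType) : probability cantor R :=
  distribution (uniform_prob (@ltr01 R)) (@binary_digits R).

Definition dominates (f g : nat -> nat) : Prop :=
  exists m, forall n, m < n -> g n < f n.

Definition ae_dominating (R : realType) (A : nat -> bool) : Prop :=
  {ae fair_coin R, forall X, forall g, computable_in X g ->
     exists2 f, computable_in A f & dominates f g}.

Lemma npair_inj a b a' b' : npair a b = npair a' b' -> a = a' /\ b = b'.
Proof. by move=> /Cantor.to_nat_inj [-> ->]. Qed.

Lemma npairK n : npair (nfst n) (nsnd n) = n.
Proof.
by rewrite /npair /nfst /nsnd -surjective_pairing Cantor.cancel_to_of.
Qed.

Lemma nfst_le n : nfst n <= n.
Proof.
by have := Cantor.to_nat_non_decreasing (nfst n) (nsnd n);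
  rewrite -/(npair _ _) npairK; lia.
Qed.

Lemma nsnd_le n : nsnd n <= n.
Proof.
by have := Cantor.to_nat_non_decreasing (nfst n) (nsnd n);
  rewrite -/(npair _ _) npairK; lia.
Qed.

Lemma index_inj : injective index.
Proof.
elim=> [||||| f IHf g IHg| f IHf g IHg| f IHf g IHg| f IHf]
  [||||| f' g'| f' g'| f' g'| f'] //=;
  try lia; move=> h.
- have /npair_inj [/IHf -> /IHg -> //] :
    npair (index f) (index g) = npair (index f') (index g') by lia.
- have /npair_inj [/IHf -> /IHg -> //] :
    npair (index f) (index g) = npair (index f') (index g') by lia.
- have /npair_inj [/IHf -> /IHg -> //] :
    npair (index f) (index g) = npair (index f') (index g') by lia.
- by rewrite (IHf f') //; lia.
Qed.

Lemma index_surj e : exists c, index c = e.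
Proof.
elim/ltn_ind: e => e IH.
have [|e5] := leqP e 4.
  case: e {IH} => [|[|[|[|[|//]]]]] _;
    [exists CZero|exists CSucc|exists CFst|exists CSnd|exists COracle];
    reflexivity.
pose q := (e - 5) %/ 4.
have eE : e = 4 * q + 5 + (e - 5) %% 4 by rewrite /q; lia.
have qe : q < e by lia.
have [f fE] := IH (nfst q) (leq_ltn_trans (nfst_le q) qe).
have [g gE] := IH (nsnd q) (leq_ltn_trans (nsnd_le q) qe).
have [h hE] := IH q qe.
have : (e - 5) %% 4 < 4 by rewrite ltn_mod.
case: ((e - 5) %% 4) eE => [|[|[|[|//]]]] eE _.
- by exists (CPair f g); rewrite /= fE gE npairK; lia.
- by exists (CComp f g); rewrite /= fE gE npairK; lia.
- by exists (CPrec f g); rewrite /= fE gE npairK; lia.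
- by exists (CMu h); rewrite /= hE; lia.
Qed.

Lemma index_bij : bijective index.
Proof.
have /choice [d dE] : forall e, exists c, index c = e by exact: index_surj.
by exists d => // c; apply: index_inj; rewrite dE.
Qed.

Lemma eval_functional A c n m m' : eval A c n m -> eval A c n m' -> m = m'.
Proof.
elim: c n m m' => [||||| f IHf g IHg| f IHf g IHg| f IHf g IHg| f IHf]
  n m m' /=;
  try by move=> -> ->.
- move=> [a [b [fa gb ->]]] [a' [b' [fa' gb' ->]]].
  by rewrite (IHf _ _ _ fa fa') (IHg _ _ _ gb gb').
- by move=> [k gk fk] [k' gk' fk']; rewrite (IHg _ _ _ gk gk') in fk;
    exact: IHf fk fk'.
- elim: (nsnd n) m m' => [|k IH] m m'; first exact: IHf.
  by move=> [r pr gr] [r' pr' gr']; rewrite (IH _ _ pr pr') in gr;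
    exact: IHg gr gr'.
- move=> [fm mm] [fm' mm'].
  have [lt|lt|//] := ltngtP m m'.
  + by have [v /IHf /(_ fm)] := mm' _ lt.
  + by have [v /IHf /(_ fm')] := mm _ lt.
Qed.

Lemma phi_functional A e n m m' : phi A e n m -> phi A e n m' -> m = m'.
Proof.
by move=> [c <- ec] [c' /index_inj -> ec']; exact: eval_functional ec ec'.
Qed.

Section fair_coin_cylinder.
Variable R : realType.
Local Open Scope ring_scope.

Lemma binary_digits_cylinder (s : seq bool) : exists2 k : nat,
  (k < 2 ^ size s)%N & forall x : R, 0 <= x < 1 ->
    cylinder s (binary_digits x) <-> Num.truncn (2 ^+ size s * x) = k.
Proof.
elim/last_ind: s => [|s b [k k2 IH]].
  exists 0%N => // x /andP[x0 x1]; split=> // _.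
  by rewrite expr0 mul1r; apply/truncn_def; rewrite x0 x1.
exists (k.*2 + b)%N; first by rewrite size_rcons expnS; case: (b) => /=; lia.
move=> x x01; have [x0 x1] := andP x01.
set y := 2 ^+ size s * x.
have y0 : 0 <= y by rewrite mulr_ge0// exprn_ge0.
have tE : Num.truncn (2 * y) = ((Num.truncn y).*2 + odd (Num.truncn (2 * y)))%N.
  have /andP[t1 t2] := truncn_itv y0.
  have y20 : 0 <= 2 * y by rewrite mulr_ge0.
  have l1 : ((Num.truncn y).*2 <= Num.truncn (2 * y))%N.
    by rewrite truncn_ge_nat// -mul2n natrM ler_pM2l.
  have l2 : (Num.truncn (2 * y) < (Num.truncn y).+1.*2)%N.
    by rewrite truncn_lt_nat// -mul2n natrM ltr_pM2l.
  lia.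
rewrite size_rcons exprS -mulrA -/y; split.
- move=> h.
  have /(IH _ x01) hk : cylinder s (binary_digits x).
    move=> i si; rewrite h ?size_rcons; last by rewrite ltnS ltnW.
    by rewrite nth_rcons si.
  have := h (size s); rewrite size_rcons ltnSn nth_rcons ltnn eqxx => /(_ isT).
  by rewrite /binary_digits exprS -mulrA -/y tE -/y hk => <-; lia.
- move=> h i; rewrite size_rcons ltnS leq_eqVlt nth_rcons.
  have [-> _|ne /= si] := eqVneq i (size s).
    by rewrite ltnn /binary_digits exprS -mulrA -/y h oddD odd_double; case: (b).
  rewrite si; move: i si {ne}; apply/(IH _ x01); rewrite -/y.
  by case: (b) h; lia.
Qed.

Lemma fair_coin_cylinder (s : seq bool) :
  fair_coin R (cylinder s) = (2 ^- size s)%:E.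
Proof.
have [k k2 kE] := binary_digits_cylinder s.
set U : set R := @binary_digits R @^-1` cylinder s.
have mU : measurable (U : set (measurableTypeR R)).
  rewrite -[X in measurable X]setTI; apply: measurable_binary_digits => //.
  by apply: sub_sigma_algebra; exists s.
pose c : R := 2 ^+ size s.
have c0 : 0 < c by rewrite exprn_gt0.
pose J : set R := `[k%:R / c, k.+1%:R / c[%classic.
have JE x : J x <-> k%:R <= c * x < k.+1%:R.
  by rewrite /J /= in_itv/= ler_pdivrMr// ltr_pdivlMr// mulrC.
have J01 x : J x -> 0 <= x < 1.
  rewrite JE => /andP[h1 h2]; apply/andP; split.
    by rewrite -(pmulr_rge0 _ c0); exact: le_trans h1.
  rewrite -(ltr_pM2l c0) mulr1; apply: lt_le_trans h2 _.
  by rewrite /c -natrX ler_nat.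
have JU x : 0 <= x < 1 -> J x <-> U x.
  move=> x01; rewrite /U/= (kE _ x01) JE -/c.
  split=> [|<-]; first exact: truncn_def.
  by apply: truncn_itv; case/andP: x01 => ? _; rewrite mulr_ge0// ltW.
have mJ : measurable (J : set (measurableTypeR R)) by exact: measurable_itv.
have muJ : lebesgue_measure J = (c^-1)%:E.
  rewrite /J lebesgue_measure_itv/= lte_fin ltr_pM2r ?invr_gt0// ltr_nat ltnSn.
  by rewrite -EFinB -mulrBl -natrB// subSnn mul1r.
have -> : fair_coin R (cylinder s) = lebesgue_measure (U `&` `[0%R, 1%R]%classic).
  rewrite /fair_coin/= /distribution /pushforward /= -/U /uniform_prob.
  rewrite integral_uniform_pdf.
  rewrite (eq_integral (fun=> 1%:E)); last first.
    move=> x; rewrite inE/= => -[_]; rewrite /= /uniform_pdf in_itv/= => ->.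
    by rewrite subr0 invr1.
  by rewrite integral_cst ?mul1e//; exact: measurableI.
rewrite -muJ; apply/eqP; rewrite eq_le; apply/andP; split.
- have -> : lebesgue_measure J = lebesgue_measure (J `|` [set 1%R]).
    by rewrite measureU0//; exact: lebesgue_measure_set1.
  apply: le_measure; rewrite ?inE; [exact: measurableI|exact: measurableU|].
  move=> x [Ux]; rewrite /= in_itv/= => /andP[x0].
  rewrite le_eqVlt => /orP[/eqP->|x1].
    by right.
  by left; apply/JU => //; rewrite x0 x1.
- apply: le_measure; rewrite ?inE//; first exact: measurableI.
  move=> x Jx; have x01 := J01 _ Jx; split; first exact/JU.
  by case/andP: x01 => x0 /ltW x1; rewrite /= in_itv/= x0 x1.
Qed.

End fair_coin_cylinder.

(* Main.v *)
(** A random [X] computes, with positive probability, a total function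
    [fireworks X] that no computable function dominates: for each [e] it waits for
    the value of the [e]-th partial computable function at a position whose choice
    makes an infinite wait have probability at most [2^-(e+2)].  Say that
    [fireworks] escapes [A] if every [A]-computable function dominates
    [fireworks X] only for a null set of [X]; such an [A] is not a.e. dominating.

    Given such an [A] and any set [Z], let [B = A + F] where [F <x, y>] tends to
    [Z x] as [y] grows, with [F] generic for finite conditions that lock finitely
    many columns to their limits.  Then [Z <=_T B'].  Moreover [fireworks] escapes [B]: if a
    functional is not made partial by some condition, a chain of extensions
    computes from [A] values [f 0, f 1, ...] of it; since [fireworks] escapes [A], finitely
    many of these values already bound [fireworks X] only on a small set of [X],
    and some condition on the chain forces exactly these values.  Iterating with
    [Z] coding the double jumps of all sets computable in [A] gives an increasing
    sequence whose lower cones form the ideal. *)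

Require Import Defs.
From mathcomp Require Import all_boot all_classical all_reals all_analysis.
From mathcomp Require Import zify.
From mathcomp Require Import all_order all_algebra.
Import Order.TTheory GRing.Theory Num.Theory.
(* The libraries shadow [eval] and [index]. *)
Import Defs.
Set Implicit Arguments.
Unset Strict Implicit.
Unset Printing Implicit Defensive.

(** * Pairing, and closure properties of the functions computable in an oracle *)

Lemma nfst_npair a b : nfst (npair a b) = a.
Proof. by have [] := npair_inj (npairK (npair a b)). Qed.

Lemma nsnd_npair a b : nsnd (npair a b) = b.
Proof. by have [] := npair_inj (npairK (npair a b)). Qed.

Definition npairE := (nfst_npair, nsnd_npair).

Lemma nsnd0 : nsnd 0 = 0. Proof. by []. Qed.

Lemma nsnd_lt n : 0 < n -> nsnd n < n.
Proof.
move=> n0; rewrite ltn_neqAle nsnd_le andbT; apply/eqP => sE.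
have := Cantor.to_nat_spec (nfst n) (nsnd n).
rewrite -/(npair _ _) npairK; move: (nfst n) sE => a ->; nia.
Qed.

Definition comp (A : nat -> bool) (f : nat -> nat) : Prop :=
  exists c, forall n, eval A c n (f n).

Lemma computable_inE A f : computable_in A f <-> comp A f.
Proof.
split=> [[e eP]|[c cP]]; last by exists (index c) => n; exists c.
have [c cE] := index_surj e.
by exists c => n; have [c' c'E] := eP n; rewrite -cE in c'E; rewrite -(index_inj c'E).
Qed.

Section Closure.
Variable A : nat -> bool.
Implicit Types (f g h k : nat -> nat) (b c : nat -> bool).

Lemma eq_comp f g : f =1 g -> comp A f -> comp A g.
Proof. by move=> fg [c cP]; exists c => n; rewrite -fg. Qed.

Lemma comp_oracle : comp A (fun n => A n).
Proof. by exists COracle. Qed.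

Lemma comp_comp f g : comp A f -> comp A g -> comp A (fun x => f (g x)).
Proof. by move=> [c cP] [d dP]; exists (CComp c d) => n; exists (g n). Qed.

Lemma comp_query f : comp A f -> comp A (fun x => A (f x)).
Proof. exact: (comp_comp comp_oracle). Qed.

Lemma comp_pair f g : comp A f -> comp A g -> comp A (fun x => npair (f x) (g x)).
Proof. by move=> [c cP] [d dP]; exists (CPair c d) => n; exists (f n), (g n). Qed.

Lemma comp_fst f : comp A f -> comp A (fun x => nfst (f x)).
Proof. by apply: comp_comp; exists CFst. Qed.

Lemma comp_snd f : comp A f -> comp A (fun x => nsnd (f x)).
Proof. by apply: comp_comp; exists CSnd. Qed.

Lemma comp_succ f : comp A f -> comp A (fun x => (f x).+1).
Proof. by apply: comp_comp; exists CSucc. Qed.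

Lemma comp_id : comp A (fun x => x).
Proof.
by apply: (eq_comp npairK); apply: comp_pair; [exists CFst|exists CSnd].
Qed.

Lemma comp_cst m : comp A (fun=> m).
Proof. by elim: m => [|m IH]; [exists CZero|apply: comp_succ]. Qed.

Lemma comp_rec f (G : nat -> nat -> nat -> nat) k :
  comp A f -> comp A (fun p => G (nfst p) (nfst (nsnd p)) (nsnd (nsnd p))) ->
  comp A k -> comp A (fun x => nat_rect (fun=> nat) (f x) (G x) (k x)).
Proof.
move=> [cf cfP] [cg cgP] hk.
have [d dP] : comp A (fun p => nat_rect (fun=> nat) (f (nfst p)) (G (nfst p)) (nsnd p)).
  exists (CPrec cf cg) => p /=; elim: (nsnd p) => [|j IH]; first exact: cfP.
  eexists; first exact: IH.
  by have := cgP (npair (nfst p) (npair j (nat_rect (fun=> nat) (f (nfst p)) (G (nfst p)) j)));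
    rewrite !npairE.
have [c cP] := comp_pair comp_id hk.
by exists (CComp d c) => n; eexists; [exact: cP|have := dP (npair n (k n)); rewrite !npairE].
Qed.

Lemma comp_iter (F : nat -> nat -> nat) f k :
  comp A (fun p => F (nfst p) (nsnd p)) -> comp A f -> comp A k ->
  comp A (fun x => iter (k x) (F x) (f x)).
Proof.
move=> hF hf hk.
apply: (@eq_comp (fun x => nat_rect (fun=> nat) (f x) (fun _ r => F x r) (k x))).
  by move=> x; elim: (k x) => //= j ->.
apply: comp_rec => //.
apply: (@eq_comp (fun p => F (nfst (npair (nfst p) (nsnd (nsnd p))))
                             (nsnd (npair (nfst p) (nsnd (nsnd p)))))).
  by move=> p; rewrite !npairE.
apply: (comp_comp hF); apply: comp_pair; first exact: comp_fst comp_id.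
exact/comp_snd/comp_snd/comp_id.
Qed.

Lemma comp_pred f : comp A f -> comp A (fun x => (f x).-1).
Proof.
move=> hf; apply: (@eq_comp (fun x => nat_rect (fun=> nat) 0 (fun j _ => j) (f x))).
  by move=> x; case: (f x).
apply: (comp_rec (G := fun _ j _ => j)) => //; first exact: comp_cst.
exact/comp_fst/comp_snd/comp_id.
Qed.

Lemma comp_add f g : comp A f -> comp A g -> comp A (fun x => f x + g x).
Proof.
move=> hf hg; apply: (@eq_comp (fun x => iter (g x) succn (f x))).
  by move=> x; rewrite iter_succn addnC.
by apply: (comp_iter (F := fun=> succn)) => //; exact/comp_succ/comp_snd/comp_id.
Qed.

Lemma comp_sub f g : comp A f -> comp A g -> comp A (fun x => f x - g x).
Proof.
move=> hf hg; apply: (@eq_comp (fun x => iter (g x) predn (f x))).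
  by move=> x; elim: (g x) => [|n] /=; lia.
by apply: (comp_iter (F := fun=> predn)) => //; exact/comp_pred/comp_snd/comp_id.
Qed.

Lemma comp_eqn f g : comp A f -> comp A g -> comp A (fun x => f x == g x).
Proof.
move=> hf hg; apply: (@eq_comp (fun x => 1 - ((f x - g x) + (g x - f x)))).
  by move=> x; case: eqP; lia.
by apply: comp_sub; [exact: comp_cst|apply: comp_add; apply: comp_sub].
Qed.

Lemma comp_leq f g : comp A f -> comp A g -> comp A (fun x => f x <= g x).
Proof.
move=> hf hg; apply: (@eq_comp (fun x => 1 - (f x - g x))).
  by move=> x; case: leqP; lia.
by apply: comp_sub; [exact: comp_cst|apply: comp_sub].
Qed.

Lemma comp_if b f g : comp A (fun x => b x) -> comp A f -> comp A g ->
  comp A (fun x => if b x then f x else g x).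
Proof.
move=> hb hf hg.
apply: (@eq_comp (fun x => nat_rect (fun=> nat) (g x) (fun _ _ => f x) (b x))).
  by move=> x; case: (b x).
by apply: (comp_rec (G := fun x _ _ => f x)) => //; apply: comp_comp => //;
  exact: comp_fst comp_id.
Qed.

Lemma comp_neg b : comp A (fun x => b x) -> comp A (fun x => ~~ b x).
Proof.
move=> hb; apply: (@eq_comp (fun x => if b x then 0 else 1)).
  by move=> x; case: (b x).
by apply: comp_if => //; exact: comp_cst.
Qed.

Lemma comp_and b c : comp A (fun x => b x) -> comp A (fun x => c x) ->
  comp A (fun x => b x && c x).
Proof.
move=> hb hc; apply: (@eq_comp (fun x => if b x then (c x : nat) else 0)).
  by move=> x; case: (b x).
by apply: comp_if => //; exact: comp_cst.
Qed.

Lemma comp_all (P : nat -> nat -> bool) k :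
  comp A (fun p => P (nfst p) (nsnd p)) -> comp A k ->
  comp A (fun x => all (P x) (iota 0 (k x))).
Proof.
move=> hP hk.
apply: (@eq_comp (fun x => nat_rect (fun=> nat) 1 (fun j r => P x j && (r == 1)) (k x))).
  move=> x; elim: (k x) => [|j IH] //.
  by rewrite -[in RHS]addn1 iotaD add0n all_cat [LHS]/= IH eqb1 /= andbT andbC.
apply: (comp_rec (G := fun x j r => P x j && (r == 1))) => //; first exact: comp_cst.
apply: comp_and; last first.
  by apply: comp_eqn; [exact/comp_snd/comp_snd/comp_id|exact: comp_cst].
apply: (@eq_comp (fun p => P (nfst (npair (nfst p) (nfst (nsnd p))))
                             (nsnd (npair (nfst p) (nfst (nsnd p)))))).
  by move=> p; rewrite !npairE.
apply: (comp_comp hP); apply: comp_pair; first exact: comp_fst comp_id.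
exact/comp_fst/comp_snd/comp_id.
Qed.

Lemma comp_odd f : comp A f -> comp A (fun x => odd (f x)).
Proof.
move=> hf; apply: (@eq_comp (fun x => iter (f x) (fun r => r == 0) 0)).
  by move=> x; elim: (f x) => //= n ->; rewrite eqb0.
apply: (comp_iter (F := fun _ r => r == 0)) => //; last exact: comp_cst.
by apply: comp_eqn; [exact: comp_snd comp_id|exact: comp_cst].
Qed.

Lemma comp_half f : comp A f -> comp A (fun x => (f x)./2).
Proof.
move=> hf.
apply: (@eq_comp (fun x => nat_rect (fun=> nat) 0 (fun j r => odd j + r) (f x))).
  by move=> x; elim: (f x) => //= n ->; lia.
apply: (comp_rec (G := fun _ j r => odd j + r)) => //; first exact: comp_cst.
apply: comp_add; last exact/comp_snd/comp_snd/comp_id.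
exact/comp_odd/comp_fst/comp_snd/comp_id.
Qed.

(** The least zero [h] is given in advance as a total function, since unbounded search by itself
    need not have a value. *)
Lemma comp_min (T : nat -> nat -> nat) h :
  comp A (fun p => T (nfst p) (nsnd p)) ->
  (forall x, T x (h x) = 0) -> (forall x i, i < h x -> T x i != 0) -> comp A h.
Proof.
move=> [c cP] h0 hmin; exists (CMu c) => x; split.
  by have := cP (npair x (h x)); rewrite !npairE h0.
move=> k /hmin kh; exists (T x k).-1.
by have := cP (npair x k); rewrite !npairE prednK// lt0n.
Qed.

Lemma comp_bin (F : nat -> nat -> nat) f g : comp A (fun p => F (nfst p) (nsnd p)) ->
  comp A f -> comp A g -> comp A (fun x => F (f x) (g x)).
Proof.
move=> hF hf hg.
apply: (@eq_comp (fun x => F (nfst (npair (f x) (g x))) (nsnd (npair (f x) (g x))))).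
  by move=> x; rewrite !npairE.
exact: (comp_comp hF (comp_pair hf hg)).
Qed.

(** Only the constants [h 0], ..., [h (N - 1)] enter the code, so [h] itself may be
    noncomputable. *)
Lemma comp_finite (h : nat -> nat) N : comp A (fun j => if j < N then h j else 0).
Proof.
elim: N => [|N IH]; first exact: comp_cst.
apply: (@eq_comp (fun j => if j == N then h N else if j < N then h j else 0)).
  move=> j; case: eqVneq => [->|jN]; first by rewrite ltnSn.
  by rewrite ltnS (leq_eqVlt j) (negPf jN).
apply: comp_if => //; last exact: comp_cst.
by apply: comp_eqn; [exact: comp_id|exact: comp_cst].
Qed.

End Closure.

(* Syntactic matching: unification would unfold [npair]. *)
Ltac comp_step :=
  lazymatch goal with
  | |- comp _ (fun x => x) => apply: comp_id
  | |- comp _ nfst => exact: (comp_fst (comp_id _))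
  | |- comp _ nsnd => exact: (comp_snd (comp_id _))
  | |- comp _ half => exact: (comp_half (comp_id _))
  | |- comp _ predn => exact: (comp_pred (comp_id _))
  | |- comp _ S => exact: (comp_succ (comp_id _))
  | |- comp _ (fun x => let _ := _ in _) => cbv zeta
  | |- comp _ (fun x => npair _ _) => apply: comp_pair
  | |- comp _ (fun x => nfst _) => apply: comp_fst
  | |- comp _ (fun x => nsnd _) => apply: comp_snd
  | |- comp _ (fun x => _.+1) => first [apply: comp_cst | apply: comp_succ]
  | |- comp _ (fun x => _.-1) => apply: comp_pred
  | |- comp _ (fun x => _ + _) => apply: comp_add
  | |- comp _ (fun x => _ - _) => apply: comp_sub
  | |- comp _ (fun x => _./2) => apply: comp_half
  | |- comp _ (fun x => if _ then _ else _) => apply: comp_if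
  | |- comp _ (fun x => nat_of_bool (~~ _)) => apply: comp_neg
  | |- comp _ (fun x => nat_of_bool (_ && _)) => apply: comp_and
  | |- comp _ (fun x => nat_of_bool (_ == _)) => apply: comp_eqn
  | |- comp _ (fun x => nat_of_bool (_ <= _)) => apply: comp_leq
  | |- comp _ (fun x => nat_of_bool (odd _)) => apply: comp_odd
  | |- comp ?A (fun x => nat_of_bool (?A _)) => apply: comp_query
  | |- comp _ _ => first [assumption | apply: comp_cst]
  end.
Ltac comp_auto := repeat comp_step.

(** * A universal stack machine *)

(* A state is a pair of a stack of frames and a value.  An oracle is a function
   [o] with [o n = b.+1] when [b] is the answer to the query [n], and [o n = 0]
   when the answer is unknown; the machine stays forever at such a query. *)
Fixpoint enc (c : code) : nat :=
  match c with
  | CZero => npair 0 0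
  | CSucc => npair 1 0
  | CFst => npair 2 0
  | CSnd => npair 3 0
  | COracle => npair 4 0
  | CPair f g => npair 5 (npair (enc f) (enc g))
  | CComp f g => npair 6 (npair (enc f) (enc g))
  | CPrec f g => npair 7 (npair (enc f) (enc g))
  | CMu f => npair 8 (enc f)
  end.

Definition push (fr K : nat) : nat := (npair fr K).+1.

(** Tags 0 to 8 are those of [enc]. Tags 9 and 10 are continuations of a pairing, after its first
    and its second component; 11 continues a primitive recursion, and the last branch, tag 12, a
    minimisation. The empty stack is 0 and means that the machine has halted. *)
Definition step (o : nat -> nat) (st : nat) : nat :=
  let S := nfst st in let v := nsnd st in
  let K := nsnd S.-1 in let t := nfst (nfst S.-1) in let d := nsnd (nfst S.-1) in
  if S == 0 then st
  else if t == 0 then npair K 0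
  else if t == 1 then npair K v.+1
  else if t == 2 then npair K (nfst v)
  else if t == 3 then npair K (nsnd v)
  else if t == 4 then if o v == 0 then st else npair K (o v).-1
  else if t == 5 then npair (push (nfst d) (push (npair 9 (npair (nsnd d) v)) K)) v
  else if t == 6 then npair (push (nsnd d) (push (nfst d) K)) v
  else if t == 7 then
    if nsnd v == 0 then npair (push (nfst d) K) (nfst v)
    else npair (push (npair 7 d)
                 (push (npair 11 (npair (nsnd d) (npair (nfst v) (nsnd v).-1))) K))
               (npair (nfst v) (nsnd v).-1)
  else if t == 8 then npair (push d (push (npair 12 (npair d (npair v 0))) K)) (npair v 0)
  else if t == 9 then npair (push (nfst d) (push (npair 10 v) K)) (nsnd d)
  else if t == 10 then npair K (npair d v)
  else if t == 11 then
    npair (push (nfst d) K) (npair (nfst (nsnd d)) (npair (nsnd (nsnd d)) v))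
  else if v == 0 then npair K (nsnd (nsnd d))
  else let w := npair (nfst (nsnd d)) (nsnd (nsnd d)).+1 in
    npair (push (nfst d) (push (npair 12 (npair (nfst d) w)) K)) w.

Definition run (o : nat -> nat) (e s n : nat) : nat :=
  let st := iter s (step o) (npair (push e 0) n) in
  if nfst st == 0 then (nsnd st).+1 else 0.

Definition total_oracle (A : nat -> bool) : nat -> nat := fun n => (A n).+1.

Section Machine.
Variable o : nat -> nat.

Lemma iter_step_halted s st : nfst st = 0 -> iter s (step o) st = st.
Proof. by move=> h; elim: s => //= s ->; rewrite /step h. Qed.

Lemma run_mono e s s' n v : s <= s' -> run o e s n = v.+1 -> run o e s' n = v.+1.
Proof.
move=> ss'; rewrite /run -(subnK ss') iterD.
case: eqP => // h [vE]; rewrite iter_step_halted// h vE//.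
Qed.

Lemma run_fun e s s' n v v' : run o e s n = v.+1 -> run o e s' n = v'.+1 -> v = v'.
Proof.
move=> rs rs'; have [le|/ltnW le] := leqP s s'.
  by have := run_mono le rs; rewrite rs' => -[].
by have := run_mono le rs'; rewrite rs => -[].
Qed.

End Machine.

Definition reaches o st st' := exists s, iter s (step o) st = st'.

Lemma reaches_trans o x y z : reaches o x y -> reaches o y z -> reaches o x z.
Proof. by move=> [s <-] [s' <-]; exists (s' + s); rewrite iterD. Qed.

Lemma reaches_step o x y : reaches o (step o x) y -> reaches o x y.
Proof. by move=> [s <-]; exists s.+1; rewrite iterSr. Qed.

Lemma reaches_refl o x : reaches o x x. Proof. by exists 0. Qed.

(** The rest [K] of the stack is arbitrary so that the runs of subcodes can be chained. *)
Lemma eval_reaches A c n m K : eval A c n m ->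
  reaches (total_oracle A) (npair (push (enc c) K) n) (npair K m).
Proof.
elim: c n m K => [||||| f IHf g IHg| f IHf g IHg| f IHf g IHg| f IHf] n m K /=.
1-5: by move=> ->; exists 1; rewrite /= /step /push !npairE /= ?npairE /=.
- move=> [a [b [fa gb ->]]].
  apply: reaches_step; rewrite /step /push !npairE /= ?npairE /=.
  apply: reaches_trans (IHf _ _ _ fa) _.
  apply: reaches_step; rewrite /step /push !npairE /= ?npairE /=.
  apply: reaches_trans (IHg _ _ _ gb) _.
  by apply: reaches_step; rewrite /step /push !npairE /= ?npairE /=; exact: reaches_refl.
- move=> [k gk fk].
  apply: reaches_step; rewrite /step /push !npairE /= ?npairE /=.
  exact: reaches_trans (IHg _ _ _ gk) (IHf _ _ _ fk).
- move: (nfst n) (nsnd n) (npairK n) => a k <- {n}; elim: k m K => [|k IH] m K.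
    move=> fm; apply: reaches_step; rewrite /step /push !npairE /= ?npairE /=.
    exact: IHf.
  move=> [r pr gr].
  apply: reaches_step; rewrite /step /push !npairE /= ?npairE /=.
  apply: reaches_trans (IH _ _ pr) _.
  apply: reaches_step; rewrite /step /push !npairE /= ?npairE /=.
  exact: IHg.
- move=> [fm mm].
  apply: reaches_step; rewrite /step /push !npairE /= ?npairE /=.
  (* Induction on the number [j] of candidates left before the least zero [m]. *)
  suff H : forall j i, i + j = m -> reaches (total_oracle A)
      (npair (push (enc f) (push (npair 12 (npair (enc f) (npair n i))) K)) (npair n i))
      (npair K m) by apply: (H m).
  elim=> [|j IH] i ijm.
    rewrite addn0 in ijm; rewrite ijm; apply: reaches_trans (IHf _ _ _ fm) _.
    by apply: reaches_step; rewrite /step /push !npairE /= ?npairE /=; exact: reaches_refl.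
  have [|v fv] := mm i; first by lia.
  apply: reaches_trans (IHf _ _ _ fv) _.
  apply: reaches_step; rewrite /step /push !npairE /= ?npairE /=.
  by apply: IH; lia.
Qed.

Lemma comp_run_index A f : comp A f ->
  exists e, forall n, exists s, run (total_oracle A) e s n = (f n).+1.
Proof.
move=> [c cP]; exists (enc c) => n.
by have [s sE] := eval_reaches 0 (cP n); exists s; rewrite /run sE !npairE.
Qed.

(** Only the query branch consults the oracle: an unanswered query leaves the state fixed, and an
    answered one gets the same answer from [o']. *)
Lemma step_sub o o' st : (forall n, o n != 0 -> o' n = o n) ->
  step o st = st \/ step o' st = step o st.
Proof.
move=> oo'; rewrite /step; do 5 ![case: eqP => _; first by right].
case: eqP => _; last by right.
by case: eqP => [_|/eqP on0]; [left|right; rewrite !oo'// (negPf on0)].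
Qed.

Lemma run_sub o o' e s n v : (forall n, o n != 0 -> o' n = o n) ->
  run o e s n = v.+1 -> run o' e s n = v.+1.
Proof.
move=> oo'; rewrite /run; move: (npair _ n) => st.
suff H : nfst (iter s (step o) st) = 0 ->
    iter s (step o') st = iter s (step o) st.
  by case: eqP => // h [<-]; rewrite H// h.
elim: s st => [|s IH] st; first by []. 
rewrite !iterSr.
have [fixd|->] := step_sub st oo'; last exact: IH.
have fixi k : iter k (step o) st = st by elim: k => //= k ->.
by rewrite fixd fixi => h; rewrite -iterSr iter_step_halted.
Qed.

(** The use principle: a step can query the oracle only at the current value [nsnd st]. *)
Lemma run_use o e s n : exists L, forall o', (forall i, i < L -> o' i = o i) ->
  run o' e s n = run o e s n.
Proof.
rewrite /run; move: (npair _ n) => st.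
suff [L H] : exists L, forall o', (forall i, i < L -> o' i = o i) ->
    iter s (step o') st = iter s (step o) st by exists L => o' /H ->.
elim: s st => [|s IH] st; first by exists 0.
have [L HL] := IH (step o st).
exists (maxn L (nsnd st).+1) => o' oo'; rewrite !iterSr.
have -> : step o' st = step o st by rewrite /step oo'// leq_max ltnSn orbT.
by apply: HL => i iL; apply: oo'; rewrite leq_max iL.
Qed.

Lemma comp_run A (o : nat -> nat -> nat) (t e s n : nat -> nat) :
  comp A (fun p => o (nfst p) (nsnd p)) ->
  comp A t -> comp A e -> comp A s -> comp A n ->
  comp A (fun x => run (o (t x)) (e x) (s x) (n x)).
Proof.
move=> ho ht he hs hn.
have hst : comp A (fun x => iter (s x) (step (o (t x))) (npair (push (e x) 0) (n x))).
  apply: (comp_iter (F := fun x => step (o (t x)))) => //; last by rewrite /push; comp_auto.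
  have hov : comp A (fun p => o (t (nfst p)) (nsnd (nsnd p))).
    apply: (comp_bin ho); last by comp_auto.
    by apply: (comp_comp ht); comp_auto.
  by rewrite /step /push; comp_auto.
by rewrite /run; comp_auto.
Qed.

(** * Transitivity of Turing reducibility *)

Lemma comp_trans A X f : comp X f -> comp A (fun n => X n) -> comp A f.
Proof.
move=> [c cP] [d dP].
suff [c' c'P] : exists c', forall n m, eval X c n m -> eval A c' n m.
  by exists c' => n; exact: c'P.
elim: c {f cP} => [||||| f [f' F] g [g' G]| f [f' F] g [g' G]| f [f' F] g [g' G]| f [f' F]].
- by exists CZero.
- by exists CSucc.
- by exists CFst.
- by exists CSnd.
- by exists d => n m /= ->; exact: dP.
- exists (CPair f' g') => n m /= [a [b [fa gb ->]]].
  by exists a, b; split=> //; [exact: F|exact: G].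
- exists (CComp f' g') => n m /= [k gk fk].
  by exists k; [exact: G|exact: F].
- exists (CPrec f' g') => n m /=; elim: (nsnd n) m => [|k IH] m; first exact: F.
  by move=> [r pr gr]; exists r; [exact: IH|exact: G].
- exists (CMu f') => n m /= [fm mm]; split; first exact: F.
  by move=> k /mm [v fv]; exists v; exact: F.
Qed.

Lemma Tle_trans A B C : Tle A B -> Tle B C -> Tle A C.
Proof. by move=> /computable_inE AB /computable_inE BC; exact/computable_inE/(comp_trans AB). Qed.

(** * The jump *)

Fixpoint const_code (k : nat) : code := if k is k'.+1 then CComp CSucc (const_code k') else CZero.

Lemma eval_const_code A k n m : eval A (const_code k) n m <-> m = k.
Proof.
elim: k m => //= k IH m; split=> [[r /IH -> ->]//|->].
by exists k => //; exact/IH.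
Qed.

(** An instance of the s-m-n theorem: [q n] is the index of a code that discards its input and runs
    [c] on [n], so the diagonal jump answers questions about arbitrary inputs. *)
Lemma jump_index B c : exists q : nat -> nat, (forall A, comp A q) /\
  forall n, jump B (q n) = `[< exists m, eval B c n m >].
Proof.
exists (fun n => index (CComp c (const_code n))); split=> [A|n].
  have hk : comp A (fun n => index (const_code n)).
    (* This recursion follows [index] on [CComp CSucc _], with 1 the index of [CSucc] and the factor
       4 written as sums. *)
    apply: (@eq_comp _ (fun n => nat_rect (fun=> nat) 0
      (fun _ r => (npair 1 r + npair 1 r) + (npair 1 r + npair 1 r) + 6) n)).
      by elim=> //= n ->; lia.
    apply: (comp_rec (G := fun _ _ r => (npair 1 r + npair 1 r) + (npair 1 r + npair 1 r) + 6));
      by comp_auto.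
  apply: (@eq_comp _ (fun n => let p := npair (index c) (index (const_code n)) in
    (p + p) + (p + p) + 6)); last by rewrite /=; comp_auto.
  by move=> n /=; lia.
apply: asbool_equiv_eq; split=> -[m].
  by move=> [d /index_inj -> /= [k /eval_const_code ->]]; exists m.
by move=> cm; exists m, (CComp c (const_code n)) => //=; exists n => //; exact/eval_const_code.
Qed.

(* Ask the jump for the first [y] after which one of the two values is no longer taken. *)
Lemma comp_jump_limit B (P : nat -> nat -> bool) (Z : nat -> bool) :
  comp B (fun p => P (nfst p) (nsnd p)) ->
  (forall z, exists y0, forall y, y0 <= y -> P z y = Z z) ->
  comp (jump B) (fun z => Z z).
Proof.
move=> hP hZ.
(* The jump decides whether [P z] takes the value [b] at or after [y]. *)
have hq b : exists q : nat -> nat, (forall A, comp A q) /\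
    forall z y, jump B (q (npair z y)) = `[< exists w, P z (y + w) = b >].
  have [c cP] : comp B (fun p => P (nfst (nfst p)) (nsnd (nfst p) + nsnd p) != b).
    apply: comp_neg; apply: (@eq_comp _ (fun p =>
      @eq_op nat (P (nfst (nfst p)) (nsnd (nfst p) + nsnd p)) b)).
      by move=> p; case: (P _ _); case: (b).
    by apply: comp_eqn; [apply: (comp_bin (F := fun x y => P x y)) => //; comp_auto|comp_auto].
  have [q [hq qE]] := jump_index B (CMu c); exists q; split=> // z y; rewrite qE.
  apply: asbool_equiv_eq; split=> [[m [cm _]]|[w Pw]].
    exists m; have := cP (npair (npair z y) m); rewrite !npairE => cm'.
    by have := eval_functional cm cm'; case: eqP.
  have ex : exists w, P z (y + w) == b by exists w; exact/eqP.
  exists (ex_minn ex); case: ex_minnP => m /eqP Pm mmin; split.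
    by have := cP (npair (npair z y) m); rewrite !npairE Pm eqxx.
  move=> k km; exists 0; have := cP (npair (npair z y) k); rewrite !npairE.
  case: eqP => // /eqP /mmin; lia.
have [q [hqc qE]] := hq true; have [r [hrc rE]] := hq false.
have ex z : exists y, ~~ (jump B (q (npair z y)) && jump B (r (npair z y))).
  have [y0 y0P] := hZ z; exists y0; rewrite qE rE.
  apply/negP => /andP[/asboolP[w] + /asboolP[w']].
  by rewrite !y0P ?leq_addr// => ->.
pose h z := ex_minn (ex z).
have hh : comp (jump B) h.
  apply: (@comp_min _ (fun z y => jump B (q (npair z y)) && jump B (r (npair z y)))).
  - by apply: comp_and; apply: comp_query; [apply: (comp_comp (hqc _))|
      apply: (comp_comp (hrc _))]; comp_auto.
  - by move=> z; rewrite /h; case: ex_minnP => m /negPf ->.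
  - move=> z k; rewrite /h; case: ex_minnP => m _ mmin.
    by case: (boolP (_ && _)) => // /mmin; lia.
apply: (@eq_comp _ (fun z => jump B (q (npair z (h z))))); last first.
  by apply: comp_query; apply: (comp_comp (hqc _)); comp_auto.
move=> z; rewrite /h; case: ex_minnP => y; rewrite negb_and => yP _; congr nat_of_bool.
have [y0 y0P] := hZ z.
(* The limit value does occur at or after [y], and at most one value does, so a single question
   reveals the limit. *)
have lim : P z (y + y0) = Z z by apply: y0P; exact: leq_addl.
case/orP: yP => [nq|nr].
  rewrite (negbTE nq); case: (Z z) lim => // lim; case/negP: nq.
  by rewrite qE; apply/asboolP; exists y0.
case: (Z z) lim => lim; first by rewrite qE; apply/asboolP; exists y0.
by case/negP: nr; rewrite rE; apply/asboolP; exists y0.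
Qed.

Lemma Tle_joinl A F : Tle A (Tjoin A F).
Proof.
apply/computable_inE; apply: (@eq_comp _ (fun n => Tjoin A F (n + n))).
  by move=> n; rewrite /Tjoin addnn odd_double doubleK.
by apply: comp_query; comp_auto.
Qed.

Lemma Tle_join X Y A : Tle X A -> Tle Y A -> Tle (Tjoin X Y) A.
Proof.
move=> /computable_inE hX /computable_inE hY; apply/computable_inE.
apply: (@eq_comp _ (fun n => if odd n then (Y n./2 : nat) else X n./2)).
  by move=> n; rewrite /Tjoin; case: odd.
by apply: comp_if; [comp_auto|apply: (comp_comp hY); comp_auto|
  apply: (comp_comp hX); comp_auto].
Qed.

(** * The fireworks function *)

Definition free_run (e s n : nat) : nat := run (total_oracle (fun=> false)) e s n.

(* Fireworks for the [e]-th function: the state [<j, p>] at stage [s] says that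
   the current position is [<e, p>] and that [j] earlier positions were abandoned
   because the function turned out to be defined there. *)
Definition attempt (e s : nat) : nat :=
  nat_rect (fun=> nat) (npair 0 0)
    (fun i r => if free_run e i (npair e (nsnd r)) == 0 then r else npair (nfst r).+1 i.+1) s.

Definition prefix_number (X : nat -> bool) (L : nat) : nat :=
  nat_rect (fun=> nat) 0 (fun i r => r + r + X i) L.

(* At the position reached after as many attempts as the first [e + 2] bits of [X]
   say, wait for the [e]-th function to halt and take its value plus one. *)
Definition stake (X : nat -> bool) (n : nat) : bool :=
  let e := nfst n in let s := nsnd n in
  (nsnd (attempt e s) == s) && (nfst (attempt e s) == prefix_number X e.+2).

Definition stage_test (X : nat -> bool) (n m : nat) : bool :=
  stake X n && (free_run (nfst n) m n == 0).

(** Where nothing is staked the search stops at stage 0, at which no run has halted, and the value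
    is 0. At a staked position the halted run contributes its result plus one. The default 0 stands
    for an infinite wait. *)
Definition fireworks (X : nat -> bool) (n : nat) : nat :=
  if pselect (exists m, ~~ stage_test X n m) is left ex then free_run (nfst n) (ex_minn ex) n
  else 0.

(* The wait is infinite: this determines the number of attempts, hence [e + 2] bits. *)
Definition unlucky_at (e : nat) (X : nat -> bool) : Prop :=
  exists s, stake X (npair e s) /\ forall m, free_run e m (npair e s) = 0.

Definition lucky (X : nat -> bool) : Prop := forall e, ~ unlucky_at e X.

Lemma fireworks_comp X : lucky X -> comp X (fireworks X).
Proof.
move=> luckyX.
have ex n : exists m, ~~ stage_test X n m.
  have [//|h] := pselect (exists m, ~~ stage_test X n m).
  have {}h m : stage_test X n m by apply/negPn/negP => nm; apply: h; exists m.
  case: (luckyX (nfst n)); exists (nsnd n); rewrite npairK.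
  by split=> [|m]; [have /andP[] := h 0|have /andP[_ /eqP] := h m].
pose h n := ex_minn (ex n).
apply: (@eq_comp _ (fun n => free_run (nfst n) (h n) n)).
  move=> n; rewrite /fireworks; case: pselect => [ex'|/(_ (ex n))] //.
  by rewrite /h; case: ex_minnP => m Pm mmin; case: ex_minnP => m' Pm' mmin';
    congr (free_run _ _ _); apply/eqP; rewrite eqn_leq mmin ?mmin'.
have hrun (t s n : nat -> nat) : comp X t -> comp X s -> comp X n ->
    comp X (fun x => free_run (t x) (s x) (n x)).
  move=> ht hs hn; apply: (comp_run (o := fun=> total_oracle (fun=> false)) (t := id)) => //;
    by rewrite ?/total_oracle; comp_auto.
have hatt (t s : nat -> nat) : comp X t -> comp X s -> comp X (fun x => attempt (t x) (s x)).
  move=> ht hs; apply: (comp_rec (G := fun x i r =>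
    if free_run (t x) i (npair (t x) (nsnd r)) == 0 then r else npair (nfst r).+1 i.+1)) => //.
    by comp_auto.
  have ht' : comp X (fun x => t (nfst x)) by apply: (comp_comp ht); comp_auto.
  by do ?first [apply: (hrun) | comp_step].
have hpn (t : nat -> nat) : comp X t -> comp X (fun x => prefix_number X (t x)).
  by move=> ht; apply: (comp_rec (G := fun x i r => r + r + X i)); comp_auto.
apply: (hrun); [by comp_auto| |by comp_auto].
apply: (@comp_min _ (stage_test X)).
- rewrite /stage_test /stake.
  by do ?first [apply: (hrun) | apply: (hatt) | apply: (hpn) | comp_step].
- by move=> n; rewrite /h; case: ex_minnP => m /negPf ->.
- by move=> n m; rewrite /h; case: ex_minnP => k _ kmin; case: (boolP (stage_test X n m)) => // /kmin; lia.
Qed.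

Lemma eq_prefix_number X Y L : (forall i, i < L -> X i = Y i) <->
  prefix_number X L = prefix_number Y L.
Proof.
rewrite /prefix_number; elim: L => [|L IH] //=; split=> [h|h i].
  by rewrite h// (IH.1 _)// => i iL; apply: h; lia.
have [h1 h2] : prefix_number X L = prefix_number Y L /\ X L = Y L.
  by rewrite /prefix_number; move: h; case: (X L); case: (Y L) => /= ?; split=> //; lia.
by rewrite ltnS leq_eqVlt => /orP[/eqP->//|]; apply: IH.2.
Qed.

Lemma eq_stake X Y n : (forall i, i < (nfst n).+2 -> X i = Y i) -> stake X n = stake Y n.
Proof. by move=> /eq_prefix_number; rewrite /stake => ->. Qed.

Lemma eq_fireworks X Y n : (forall i, i < (nfst n).+2 -> X i = Y i) ->
  fireworks X n = fireworks Y n.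
Proof.
move=> /eq_stake XY; rewrite /fireworks.
by have -> : stage_test X n = stage_test Y n by apply/funext => m; rewrite /stage_test XY.
Qed.

Lemma eq_unlucky_at X Y e : (forall i, i < e.+2 -> X i = Y i) -> unlucky_at e X -> unlucky_at e Y.
Proof.
move=> XY [s [st h]]; exists s; split=> //.
by rewrite -(@eq_stake X) ?npairE.
Qed.

Lemma attempt_stuck e s s' : (forall m, free_run e m (npair e (nsnd (attempt e s))) = 0) ->
  s <= s' -> attempt e s' = attempt e s.
Proof.
move=> h /subnK <-; elim: (s' - s) => //= d IH.
by rewrite -/(attempt e (d + s)) IH h eqxx.
Qed.

(** The sequence [attempt e] does not depend on the set and stops at its first undefined position.
    Both infinite waits are thus at the same state, whose number of attempts is the prefix number of
    both sets. *)
Lemma unlucky_at_prefix e X Y : unlucky_at e X -> unlucky_at e Y -> forall i, i < e.+2 -> X i = Y i.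
Proof.
move=> [s [+ hs]] [s' [+ hs']]; rewrite /stake !npairE.
move=> /andP[/eqP sE /eqP sX] /andP[/eqP sE' /eqP sY].
apply/eq_prefix_number; rewrite -sX -sY.
by have [le|/ltnW le] := leqP s s'; [rewrite -(attempt_stuck _ le)|rewrite (attempt_stuck _ le)];
  rewrite ?sE ?sE'.
Qed.

(** When the [e]-th function is total, no attempt lasts forever, so every number of attempts is
    reached, in particular the one that [X] chooses; the value staked there exceeds [f] by one. *)
Lemma fireworks_escapes X f : lucky X -> comp (fun=> false) f ->
  exists n, f n < fireworks X n.
Proof.
move=> luckyX /comp_run_index [e eP].
have uP n : exists2 m, free_run e m n != 0 & forall k, k < m -> free_run e k n = 0.
  have ex : exists m, free_run e m n != 0 by have [m mE] := eP n; exists m; rewrite /free_run mE.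
  exists (ex_minn ex); case: ex_minnP => // m _ mmin k km.
  by apply/eqP; apply: contraLR km => /mmin; lia.
have all_rounds j : exists s, attempt e s = npair j s.
  elim: j => [|j [s sE]]; first by exists 0.
  have [m m1 m2] := uP (npair e s).
  (* The attempt begun at stage [s] is abandoned at the first stage from [s] on by which the run, of
     length [m], has halted. *)
  exists (maxn s m).+1.
  have stay k : s + k <= maxn s m -> attempt e (s + k) = npair j s.
    elim: k => [|k IH] le; first by rewrite addn0.
    by rewrite addnS /= -/(attempt _ _) IH ?npairE ?m2 ?eqxx//; lia.
  have := stay (maxn s m - s); rewrite subnKC ?leq_maxl// => /(_ (leqnn _)) /= ->.
  rewrite !npairE; case: eqP => // h; exfalso; move: m1; rewrite /free_run.
  by case mE : (run _ _ _ _) => [//|v] _; move: h; rewrite /free_run (run_mono (leq_maxr s m) mE).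
have [s sE] := all_rounds (prefix_number X e.+2).
exists (npair e s).
have st : stake X (npair e s) by rewrite /stake !npairE sE !npairE !eqxx.
rewrite /fireworks; case: pselect => [ex|]; last first.
  by case; have [m m1 _] := uP (npair e s); exists m; rewrite /stage_test st npairE.
case: ex_minnP => m; rewrite /stage_test st npairE /free_run /=.
case mE : (run _ _ _ _) => [//|v] _ _.
by have [k kE] := eP (npair e s); rewrite (run_fun mE kE).
Qed.

(** * Measure *)

Section Fair_coin.
Variable R : realType.
Local Open Scope classical_set_scope.
Local Open Scope ereal_scope.

Notation mu := (fair_coin R).

Lemma measurable_cylinder s : measurable (cylinder s : set cantor).
Proof. by apply: sub_sigma_algebra; exists s. Qed.

Lemma cylinder_mkseq (X Y : nat -> bool) L :
  cylinder (mkseq X L) Y <-> forall i, (i < L)%N -> Y i = X i.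
Proof.
split=> h i; first by move=> iL; rewrite h ?size_mkseq// nth_mkseq.
by rewrite size_mkseq => iL; rewrite nth_mkseq// h.
Qed.

Lemma measurable_prefix (S : set cantor) L :
  (forall X Y, (forall i, (i < L)%N -> X i = Y i) -> S X -> S Y) -> measurable S.
Proof.
move=> hS.
have [d dK] : exists d : nat -> seq bool, forall s, exists n, d n = s.
  by exists (fun n => odflt [::] (unpickle n)) => s; exists (pickle s); rewrite pickleK.
rewrite (_ : S = \bigcup_n
  (if `[< cylinder (d n) `<=` S >] then cylinder (d n) else set0 : set cantor)).
  apply: bigcupT_measurable => n; case: asboolP => _; last exact: measurable0.
  exact: measurable_cylinder.
apply/seteqP; split=> [X SX|X [n _]]; last by case: asboolP => // sS /sS.
have [n nE] := dK (mkseq X L); exists n => //; rewrite nE; case: asboolP => [_|[]].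
  by apply/cylinder_mkseq.
by move=> Y /cylinder_mkseq XY; apply: hS SX => i /XY.
Qed.

Lemma measurable_unlucky_at e : measurable (unlucky_at e : set cantor).
Proof. by apply: (@measurable_prefix _ e.+2) => X Y XY; exact: eq_unlucky_at. Qed.

Lemma luckyE : lucky = ~` (\bigcup_e (unlucky_at e : set cantor)).
Proof.
apply/seteqP; split=> [X XP [e _]|X nX e be]; first exact: XP.
by apply: nX; exists e.
Qed.

Lemma measurable_lucky : measurable (lucky : set cantor).
Proof.
rewrite luckyE; apply: measurableC; apply: bigcupT_measurable => e.
exact: measurable_unlucky_at.
Qed.

(** All unlucky sets share their first [e + 2] bits, hence lie in one cylinder. The bound is split
    so that [epsilon_trick0] sums it over [e] to one half. *)
Lemma measure_unlucky_at e : mu (unlucky_at e) <= (2^-1 / (2 ^ e.+1)%:R)%:E.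
Proof.
have [[X bX]|nb] := pselect (exists X, unlucky_at e X); last first.
  rewrite (_ : unlucky_at e = set0) ?measure0 ?lee_fin ?divr_ge0//.
  by apply/seteqP; split=> // X bX; apply: nb; exists X.
apply: (@le_trans _ _ (mu (cylinder (mkseq X e.+2)))).
  apply: le_measure; rewrite ?inE; [exact: measurable_unlucky_at|exact: measurable_cylinder|].
  by move=> Y bY; apply/cylinder_mkseq => i ie; exact: unlucky_at_prefix bY bX _ ie.
by rewrite fair_coin_cylinder size_mkseq lee_fin natrX -invfM -exprS.
Qed.

Lemma measure_lucky : 0 < mu lucky.
Proof.
have mU : measurable (\bigcup_e (unlucky_at e : set cantor)).
  by apply: bigcupT_measurable => e; exact: measurable_unlucky_at.
have : mu (\bigcup_e (unlucky_at e : set cantor)) <= (2^-1 : R)%:E.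
  apply: le_trans (generalized_Boole_inequality mu measurable_unlucky_at mU) _.
  apply: le_trans (epsilon_trick0 xpredT _); last by rewrite invr_ge0.
  by apply: lee_nneseries => // e _; exact: measure_unlucky_at.
rewrite luckyE probability_setC// => h.
rewrite sube_gt0; apply: le_lt_trans h _.
by rewrite lte_fin invf_lt1// ltr1n.
Qed.

(** Domination is required at every [n]; finitely many exceptions are absorbed later by adding a
    constant to [f]. *)
Definition dominated (f : nat -> nat) : set cantor :=
  [set X | lucky X /\ forall n, (fireworks X n <= f n)%N].

Definition dominated_below (f : nat -> nat) (b : nat) : set cantor :=
  [set X | lucky X /\ forall n, (n < b)%N -> (fireworks X n <= f n)%N].

Lemma dominatedE f : dominated f = \bigcap_b dominated_below f b.
Proof.
apply/seteqP; split=> [X [lX h] b _|X h]; first by split=> // n _; exact: h.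
by split=> [|n]; [have [] := h 0%N I|have [_] := h n.+1 I; apply].
Qed.

Lemma measurable_dominated_below f b : measurable (dominated_below f b).
Proof.
rewrite (_ : dominated_below f b = lucky `&`
    \bigcap_(n in [set n | (n < b)%N]) [set X : cantor | (fireworks X n <= f n)%N]).
  apply: measurableI; first exact: measurable_lucky.
  apply: bigcap_measurableType => n _.
  by apply: (@measurable_prefix _ (nfst n).+2) => X Y XY; rewrite /= (eq_fireworks XY).
by apply/seteqP; split=> X [lX h]; split.
Qed.

Lemma measurable_dominated f : measurable (dominated f).
Proof.
by rewrite dominatedE; apply: bigcapT_measurable => b; exact: measurable_dominated_below.
Qed.

Definition escapes (A : nat -> bool) : Prop :=
  forall f, comp A f -> mu (dominated f) = 0.

Lemma escapes_empty : escapes (fun=> false).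
Proof.
move=> f hf; rewrite (_ : dominated f = set0) ?measure0//.
apply/seteqP; split=> // X [lX h].
by have [n] := fireworks_escapes lX hf; rewrite ltnNge h.
Qed.

(** Continuity of the measure from above along the sets [dominated_below f b]. *)
Lemma dominated_below_small f (eps : R) : (0 < eps)%R -> mu (dominated f) = 0 ->
  exists b, mu (dominated_below f b) < eps%:E.
Proof.
move=> e0 f0; apply: contrapT => /forallNP h.
have cv : mu \o dominated_below f @ \oo --> mu (\bigcap_b dominated_below f b).
  apply: nonincreasing_cvg_mu.
  - by apply: le_lt_trans (probability_le1 _ _) _ => //;
      [exact: measurable_dominated_below|rewrite ltry].
  - exact: measurable_dominated_below.
  - by rewrite -dominatedE; exact: measurable_dominated.
  - move=> b c bc; apply/subsetPset => X [lX hX]; split=> // n nb.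
    by apply: hX; exact: leq_trans nb bc.
have : eps%:E <= limn (mu \o dominated_below f).
  apply: lime_ge; first by apply/cvg_ex; eexists; exact: cv.
  by apply: nearW => b /=; rewrite leNgt; exact/negP/h.
by rewrite (cvg_lim _ cv)// -dominatedE f0 lee_fin leNgt e0.
Qed.

(** If [A] were a.e. dominating, the lucky sets would be covered by a null set and countably many
    null sets of the form [dominated], against [measure_lucky]. *)
Lemma escapes_not_ae_dominating A : escapes A -> ~ ae_dominating R A.
Proof.
move=> eA aeA.
(* [k] codes the index of an [A]-computable function and a constant to add to it. *)
pose F (k : nat) : set cantor :=
  if pselect (exists2 f : nat -> nat, comp A f &
      forall n, phi A (nfst k) n (f n)) is left ex
  then dominated (fun n => s2val (cid2 ex) n + nsnd k)%N else set0.
have nF : mu.-negligible (\bigcup_k F k).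
  apply: negligible_bigcup => k; rewrite /F; case: pselect => [ex|_]; last exact: negligible_set0.
  apply/negligibleP; first exact: measurable_dominated.
  by apply: eA; case: cid2 => f hf _ /=; comp_auto.
have : mu.-negligible (lucky : set cantor).
  apply: negligibleS (negligibleU aeA nF) => X lX.
  have [[f /[dup] hf /computable_inE hf' [m mP]]|] :=
    pselect (exists2 f, computable_in A f & dominates f (fireworks X)); last first.
    move=> no; left => /= h; apply: no; apply: h; exact/computable_inE/fireworks_comp.
  right; have [e eP] := hf.
  (* The sum bounds [fireworks X] at the exceptional arguments up to [m]. *)
  exists (npair e (\sum_(n < m.+1) fireworks X n)%N) => //; rewrite /F !npairE.
  case: pselect => [ex|]; last by case; exists f.
  case: cid2 => f' hf'' eP'; split=> //= n.
  have <- : f n = f' n by exact: phi_functional (eP n) (eP' n).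
  have [nm|/mP/ltnW] := leqP n m; last by move/leq_trans; apply; exact: leq_addr.
  apply: leq_trans (leq_addl _ _).
  by rewrite (bigD1 (Ordinal (nm : (n < m.+1)%N)))//= leq_addr.
move=> /(measure_negligible measurable_lucky) l0.
by have := measure_lucky; rewrite l0 ltxx.
Qed.

End Fair_coin.

(** * Forcing *)

Section Generic.
Variable Z : nat -> bool.

(* The condition [(N, n, h)] stands for the sets that agree with [h] below [N]
   and whose columns below [n] agree with [Z] from [N] on. *)
Record condition := Condition { len : nat; locked : nat; stem : nat -> bool }.

Definition extends (p q : condition) : Prop :=
  [/\ len p <= len q, locked p <= locked q,
      forall j, j < len p -> stem q j = stem p j &
      forall j, len p <= j < len q -> nfst j < locked p -> stem q j = Z (nfst j)].

Definition meets (p : condition) (F : nat -> bool) : Prop :=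
  (forall j, j < len p -> F j = stem p j) /\
  forall j, len p <= j -> nfst j < locked p -> F j = Z (nfst j).

Lemma extends_refl p : extends p p.
Proof. by split=> // j; lia. Qed.

Lemma extends_trans p q r : extends p q -> extends q r -> extends p r.
Proof.
move=> [N1 n1 h1 z1] [N2 n2 h2 z2]; split; [lia|lia| |].
  by move=> j jp; rewrite h2 ?h1//; lia.
move=> j jr jn; have [jq|jq] := ltnP j (len q).
  by rewrite h2// z1//; lia.
by apply: z2; lia.
Qed.

Lemma extends_meets p q F : extends p q -> meets q F -> meets p F.
Proof.
move=> [N1 n1 h1 z1] [h2 z2]; split=> j jp; first by rewrite h2 ?h1//; lia.
move=> jn; have [jq|jq] := ltnP j (len q); first by rewrite h2// z1//; lia.
by apply: z2; lia.
Qed.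

Definition dense (D : (nat -> bool) -> Prop) : Prop :=
  forall p, exists2 q, extends p q & forall F, meets q F -> D F.

(** [F] is the union of the stems along a chain of conditions that meets each [D i]. Lengths and
    numbers of locked columns grow strictly, so [F] is total and every column is eventually
    locked. *)
Lemma generic_exists (D : nat -> (nat -> bool) -> Prop) : (forall i, dense (D i)) ->
  exists F, (forall i, D i F) /\
    forall z, exists y0, forall y, y0 <= y -> F (npair z y) = Z z.
Proof.
move=> dD.
have next i p : exists q, [/\ extends p q, len p < len q, locked p < locked q &
    forall F, meets q F -> D i F].
  have [q pq qD] := dD i p.
  (* One more position, filled in accordance with every lock, and one more locked column. *)
  pose q' := Condition (len q).+1 (locked q).+1
    (fun j => if j == len q then Z (nfst j) else stem q j).
  have qq' : extends q q'.
    split=> //= j; first by case: eqP => //; lia.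
    by move=> jq; rewrite ifT//; lia.
  have [? ? _ _] := pq.
  exists q'; split=> /=; [exact: extends_trans pq qq'|lia|lia|].
  by move=> F /(extends_meets qq'); exact: qD.
have /choice [g gP] : forall ip : nat * condition, exists q,
    [/\ extends ip.2 q, len ip.2 < len q, locked ip.2 < locked q &
    forall F, meets q F -> D ip.1 F] by move=> [i p]; exact: next.
pose s i := nat_rect (fun=> condition) (Condition 0 0 (fun=> false)) (fun i p => g (i, p)) i.
have sE i : s i.+1 = g (i, s i) by [].
have s_ext i k : extends (s i) (s (k + i)).
  elim: k => [|k IH]; first exact: extends_refl.
  by apply: extends_trans IH _; rewrite addSn sE; have [] := gP (k + i, s (k + i)).
have s_mono i k : i <= k -> extends (s i) (s k).
  by move=> ik; rewrite -(subnK ik); exact: s_ext.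
have s_len i : i <= len (s i).
  by elim: i => // i IH; rewrite sE; have [_ + _ _] := gP (i, s i); move=> /=; lia.
have s_locked i : i <= locked (s i).
  by elim: i => // i IH; rewrite sE; have [_ _ + _] := gP (i, s i); move=> /=; lia.
pose F j := stem (s j.+1) j.
have FE k j : j < k -> F j = stem (s k) j.
  move=> jk; have [_ _ + _] := s_mono j.+1 k jk.
  by move=> /(_ j (s_len j.+1)) ->.
have sF i : meets (s i) F.
  split=> j ji.
    rewrite (FE (maxn i j.+1)); last by lia.
    by have [_ _ + _] := s_mono i (maxn i j.+1) (leq_maxl _ _); exact.
  move=> jn; rewrite (FE (maxn i j.+1)); last by lia.
  have [_ _ _] := s_mono i (maxn i j.+1) (leq_maxl _ _); apply=> //.
  by have := s_len (maxn i j.+1); lia.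
exists F; split=> [i|z].
  by have [_ _ _] := gP (i, s i); apply; exact: sF i.+1.
exists (len (s z.+1)) => y yz; have [_] := sF z.+1.
move=> /(_ (npair z y)); rewrite npairE; apply.
  by apply: leq_trans yz _; rewrite -{1}(nsnd_npair z y); exact: nsnd_le.
exact: s_locked z.+1.
Qed.

Lemma dense_diagonal (A C : nat -> bool) : dense (fun F => Tjoin A F <> C).
Proof.
(* [j] lies in the first unlocked column and beyond the stem, so its bit is free to differ from
   [C]. *)
move=> p; set j := npair (locked p) (len p).
have jp : len p <= j by rewrite -{1}(nsnd_npair (locked p) (len p)); exact: nsnd_le.
exists (Condition j.+1 (locked p) (fun i => if i == j then ~~ C j.*2.+1 else
    if i < len p then stem p i else Z (nfst i))).
  split=> //= [|i ip|i ip]; first by lia.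
    by rewrite ip; case: eqP => //; lia.
  case: eqP => [->|_ _]; first by rewrite npairE ltnn.
  by rewrite ifN//; lia.
move=> F [/= /(_ j (ltnSn j)) + _]; rewrite eqxx => Fj /(congr1 (fun f => f j.*2.+1)).
rewrite /Tjoin /= odd_double /= uphalf_double Fj.
by case: (C _).
Qed.

(** * Finite tables as partial oracles *)

Definition lookup (t j : nat) : nat := nfst (iter j nsnd t).

Lemma lookup_lt t j : lookup t j != 0 -> j < t.
Proof.
have le : iter j nsnd t <= t - j.
  elim: j => [|j IH] /=; first by rewrite subn0.
  have := nsnd_le (iter j nsnd t).
  by have [i0|/nsnd_lt] := posnP (iter j nsnd t); [rewrite i0 nsnd0|]; lia.
rewrite /lookup; have := nfst_le (iter j nsnd t); lia.
Qed.

Lemma lookup_encode M (w : nat -> nat) :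
  exists t, forall j, lookup t j = if j < M then w j else 0.
Proof.
elim: M w => [|M IH] w.
  exists 0 => j; rewrite /lookup; suff -> : iter j nsnd 0 = 0 by [].
  by elim: j => //= j ->.
have [t tP] := IH (fun j => w j.+1); exists (npair (w 0) t) => -[|j].
  by rewrite /lookup npairE.
by rewrite /lookup iterSr npairE -/(lookup t j) tP.
Qed.

Section Search.
Variables (A : nat -> bool) (p : condition).

(* The partial oracle for [Tjoin A F] when [F] meets [p] and, outside of the part
   of [F] decided by [p], only the values coded by [t] are known. *)
Definition known (t k : nat) : nat :=
  if odd k then
    if k./2 < len p then (stem p k./2).+1
    else if nfst k./2 < locked p then (Z (nfst k./2)).+1
    else if lookup t k./2 == 0 then 0 else if lookup t k./2 == 1 then 1 else 2
  else (A k./2).+1.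

Definition below (t t' : nat) : bool :=
  all (fun j => ~~ ((lookup t j != 0) && (lookup t' j != lookup t j))) (iota 0 t).

(** By [lookup_lt] the length [maxn (len p) t] covers every entry of [t]. Free positions without an
    entry get the bit false. *)
Definition decide (t : nat) : condition :=
  Condition (maxn (len p) t) (locked p) (fun j => if j < len p then stem p j
    else if nfst j < locked p then Z (nfst j) else 1 < lookup t j).

Lemma belowP t t' :
  reflect (forall j, lookup t j != 0 -> lookup t' j = lookup t j) (below t t').
Proof.
apply: (iffP allP) => h j.
  move=> j0; have := h j; rewrite mem_iota /= add0n lookup_lt// => /(_ isT).
  by rewrite j0 negbK => /eqP.
by move=> _; apply/negP => /andP[/h ->]; rewrite eqxx.
Qed.

Lemma known_below t t' k : below t t' -> known t k != 0 -> known t' k = known t k.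
Proof.
move=> /belowP tt'; rewrite /known; case: odd => //; case: ltnP => // _; case: ltnP => // _.
by case: (lookup t _ =P 0) => // /eqP /[dup] /negPf l0 /tt' ->; rewrite l0.
Qed.

Lemma extends_decide t : extends p (decide t).
Proof.
split=> //= [|j jp|j /andP[jp _] jn]; first by lia.
  by rewrite jp.
by rewrite ltnNge jp /= jn.
Qed.

Lemma total_joinE F k :
  total_oracle (Tjoin A F) k = if odd k then (F k./2).+1 else (A k./2).+1.
Proof. by rewrite /total_oracle /Tjoin; case: odd. Qed.

Lemma meets_decide t F j : meets (decide t) F ->
  [/\ j < len p -> F j = stem p j,
      len p <= j -> nfst j < locked p -> F j = Z (nfst j) &
      len p <= j -> locked p <= nfst j -> lookup t j != 0 -> F j = (1 < lookup t j)].
Proof.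
move=> mF; have [h z] := extends_meets (extends_decide t) mF; split; [exact: h|exact: z|].
move=> jp jn /lookup_lt jt; rewrite (mF.1 j) /=; last by rewrite leq_max jt orbT.
by rewrite ltnNge jp /= ltnNge jn.
Qed.

Lemma known_decide t F k : meets (decide t) F -> known t k != 0 ->
  total_oracle (Tjoin A F) k = known t k.
Proof.
move=> /(meets_decide k./2)[h1 h2 h3]; rewrite total_joinE /known; case: odd => //.
case: ltnP => [/h1 ->//|/[dup] kp /h2 {}h2]; case: ltnP => [/h2 ->//|kn].
case: (lookup t _ =P 0) => // /eqP /[dup] l0 /(h3 kp kn) -> _.
by case: (lookup t _) l0 => [|[|l]].
Qed.

(** Together with [run_use], this turns a halting run on the true oracle into one on a finite table
    that extends [t]. *)
Lemma known_encode t F L : meets (decide t) F -> exists2 t', below t t' &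
  forall k, k < L -> total_oracle (Tjoin A F) k = known t' k.
Proof.
move=> mF.
(* Entries of [t] are copied verbatim: [below] compares entries, although all entries above 1 mean
   true. *)
have [t' t'P] := lookup_encode (maxn L t)
  (fun j => if lookup t j != 0 then lookup t j else (F j).+1).
exists t'; first by apply/belowP => j j0; rewrite t'P j0 leq_max (lookup_lt j0) orbT.
move=> k kL; have [h1 h2 h3] := meets_decide k./2 mF.
rewrite total_joinE /known; case: odd => //.
case: ltnP => [/h1 ->//|/[dup] kp /h2 {}h2]; case: ltnP => [/h2 ->//|kn].
have kM : k./2 < maxn L t by lia.
rewrite t'P kM.
have [_|l0] := eqVneq (lookup t k./2) 0; first by case: (F _).
by rewrite /= (h3 kp kn l0); case: (lookup t _) l0 => [|[|l]].
Qed.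

Lemma comp_lookup (B : nat -> bool) (t j : nat -> nat) : comp B t -> comp B j ->
  comp B (fun x => lookup (t x) (j x)).
Proof.
move=> ht hj; apply: comp_fst; apply: (comp_iter (F := fun=> nsnd)) => //.
by comp_auto.
Qed.

(** For a fixed [p] only finitely many bits of the stem and of [Z] occur, so [A] suffices even if
    [Z] is not computable in it. *)
Lemma comp_known (t k : nat -> nat) : comp A t -> comp A k ->
  comp A (fun x => known (t x) (k x)).
Proof.
move=> ht hk.
have fin (v : nat -> nat) N (f : nat -> nat) : comp A f ->
    comp A (fun x => if f x < N then v (f x) else 0).
  by apply: (comp_comp (comp_finite A v N)).
apply: (@eq_comp _ (fun x => if odd (k x) then
    if (k x)./2 < len p then if (k x)./2 < len p then (stem p (k x)./2).+1 else 0
    else if nfst (k x)./2 < locked p then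
      if nfst (k x)./2 < locked p then (Z (nfst (k x)./2)).+1 else 0
    else if lookup (t x) (k x)./2 == 0 then 0
    else if lookup (t x) (k x)./2 == 1 then 1 else 2 else (A (k x)./2).+1)).
  by move=> x; rewrite /known; do 2 case: ltnP.
have fin1 := fin (fun j => (stem p j).+1) (len p) (fun x => (k x)./2).
have fin2 := fin (fun j => (Z j).+1) (locked p) (fun x => nfst (k x)./2).
have hl : comp A (fun x => lookup (t x) (k x)./2) by apply: comp_lookup; comp_auto.
have {}fin1 := fin1 (comp_half hk).
have {}fin2 := fin2 (comp_fst (comp_half hk)).
by apply: comp_if; [|apply: comp_if => //; [|apply: comp_if => //]|]; comp_auto.
Qed.

End Search.

End Generic.

(** * Extending a set while [fireworks] still escapes *)

Section Extension.
Variables (R : realType) (A Z : nat -> bool).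

Definition not_dominating (e : nat) (eps : R) (F : nat -> bool) : Prop :=
  let o := total_oracle (Tjoin A F) in
  (exists i, forall s, run o e s i = 0) \/
  exists b f, (forall i, i < b -> exists s, run o e s i = (f i).+1) /\
    (fair_coin R (dominated_below f b) < eps%:E)%E.

(* If the search for a longer computation always succeeds, it gives a chain that
   computes from [A] a function [f], and finitely many values of [f] suffice. *)
Lemma dense_not_dominating e (eps : R) : (0 < eps)%R -> escapes R A ->
  dense Z (not_dominating e eps).
Proof.
move=> eps0 escA p.
(* [w] codes a table that extends [t] and a number of steps. *)
pose good t i w := below t (nfst w) && (run (known Z A p (nfst w)) e (nsnd w) i != 0).
have [[t [i nogood]]|search] := pselect (exists t i, forall w, ~~ good t i w).
  (* The condition forces divergence at [i]: a halting run would use finitely many bits and yield a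
     good [w]. *)
  exists (decide Z p t); first exact: extends_decide.
  move=> F mF; left; exists i => s; apply/eqP/negPn/negP => run0.
  have [L LP] := run_use (total_oracle (Tjoin A F)) e s i.
  have [t' tt' t'P] := known_encode A L mF.
  have /negP := nogood (npair t' s); apply.
  by rewrite /good !npairE tt' LP// => k /t'P ->.
have {}search ti : exists w, good (nfst ti) (nsnd ti) w.
  apply: contrapT => no; apply: search; exists (nfst ti), (nsnd ti) => w.
  by apply/negP => gw; apply: no; exists w.
pose h ti := ex_minn (search ti).
have hP ti : good (nfst ti) (nsnd ti) (h ti) by rewrite /h; case: ex_minnP.
have comp_known' t k := @comp_known Z A p t k.
have comp_h : comp A h.
  apply: (@comp_min _ (fun ti w => ~~ good (nfst ti) (nsnd ti) w)).
  - apply: comp_neg; rewrite /good; apply: comp_and.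
      apply: (comp_all (P := fun x j => ~~ ((lookup (nfst (nfst x)) j != 0) &&
        (lookup (nfst (nsnd x)) j != lookup (nfst (nfst x)) j)))); last by comp_auto.
      by do ?[apply: comp_lookup | comp_step].
    apply: comp_neg; apply: comp_eqn; last by comp_auto.
    by apply: comp_run; [apply: comp_known'|..]; comp_auto.
  - by move=> ti; rewrite hP.
  - move=> ti w; rewrite /h; case: ex_minnP => m _ mmin; case: (boolP (good _ _ w)) => // /mmin.
    by lia.
(* [T i.+1] extends [T i] and makes the functional halt at [i]. *)
pose T i := nat_rect (fun=> nat) 0 (fun i t => nfst (h (npair t i))) i.
have comp_T : comp A T.
  apply: (comp_rec (G := fun _ i t => nfst (h (npair t i)))); [by comp_auto| |by comp_auto].
  by apply: comp_fst; apply: (comp_comp comp_h); comp_auto.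
have TP i : below (T i) (T i.+1) /\
    run (known Z A p (T i.+1)) e (nsnd (h (npair (T i) i))) i != 0.
  by have := hP (npair (T i) i); rewrite /good !npairE => /andP[].
pose f i := (run (known Z A p (T i.+1)) e (nsnd (h (npair (T i) i))) i).-1.
have comp_f : comp A f.
  apply: comp_pred; apply: (comp_run (o := known Z A p)).
  - by apply: comp_known; comp_auto.
  - by apply: (comp_comp comp_T); comp_auto.
  - by comp_auto.
  - by apply: comp_snd; apply: (comp_comp comp_h); comp_auto.
  - by comp_auto.
have [b fb] := dominated_below_small eps0 (escA _ comp_f).
(* [T b] extends all earlier tables, so this condition forces the value [f i] for every [i < b]. *)
exists (decide Z p (T b)); first exact: extends_decide.
move=> F mF; right; exists b, f; split=> // i ib.
have known_mono j k d : known Z A p (T j) k != 0 ->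
    known Z A p (T (d + j)) k = known Z A p (T j) k.
  move=> k0; elim: d => // d IH; rewrite addSn -IH.
  by apply: known_below; [have [] := TP (d + j)|rewrite IH].
exists (nsnd (h (npair (T i) i))).
have [_ ri] := TP i.
apply: (@run_sub (known Z A p (T i.+1))); last by rewrite /f prednK// lt0n.
move=> k k0; rewrite -(known_mono _ _ (b - i.+1))// subnK//.
by apply: known_decide mF _; rewrite -(subnK ib) known_mono.
Qed.

Lemma escapes_extension : escapes R A ->
  exists B, [/\ escapes R B, Tlt A B & comp (jump B) (fun z => Z z)].
Proof.
move=> escA.
(* Even requirements range over a functional and a precision [1 / (k + 1)]; odd ones diagonalise
   against the set with [A]-index [i./2], as bits are the values 0 and 1. *)
pose D i F := if odd i then Tjoin A F <> (fun n => `[< phi A i./2 n 1 >])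
  else not_dominating (nfst i./2) ((nsnd i./2).+1%:R^-1)%R F.
have [i|F [DF limF]] := generic_exists (D := D) (Z := Z).
  rewrite /D; case: odd; first exact: dense_diagonal.
  by apply: dense_not_dominating => //; rewrite invr_gt0 ltr0Sn.
exists (Tjoin A F); split.
- move=> f /comp_run_index [e eP]; apply/eqP; rewrite eq_le measure_ge0 andbT.
  apply/lee_addgt0Pr => eps eps0; rewrite add0e.
  have [k kP] : exists k : nat, (k.+1%:R^-1 < eps)%R.
    by have [k] := ltr_add_invr eps0; rewrite add0r; exists k.
  have := DF (npair e k).*2; rewrite /D odd_double doubleK !npairE.
  case=> [[i]|[b [f' [f'P f'b]]]]; first by have [s sE] := eP i => /(_ s); rewrite sE.
  apply: le_trans (ltW (lt_trans f'b _)); last by rewrite lte_fin; exact: kP.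
  apply: le_measure; rewrite ?inE; [exact: measurable_dominated|exact: measurable_dominated_below|].
  move=> X [lX h]; split=> // n nb; have [s sE] := f'P n nb; have [s' s'E] := eP n.
  by rewrite (run_fun sE s'E).
- split; first exact: Tle_joinl.
  move=> [e eP]; have := DF e.*2.+1; rewrite /D /= odd_double /= uphalf_double; apply.
  apply/funext => n; have := eP n; case: (Tjoin A F n) => h.
    by rewrite asboolT.
  by rewrite asboolF// => h'; have := phi_functional h h'.
- apply: (@comp_jump_limit _ (fun z y => F (npair z y))) => //.
  apply: (@eq_comp _ (fun p => Tjoin A F (p + p).+1)); last by comp_auto.
  by move=> p; rewrite npairK /Tjoin /= addnn odd_double /= uphalf_double.
Qed.

End Extension.

(** * The ideal generated by the iterated extensions *)

Theorem proposition6p9 (R : realType) :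
  exists I : set (nat -> bool),
    high_above_ideal I /\ forall A : nat -> bool, I A -> ~ ae_dominating R A.
Proof.
(* [Z A] codes the double jumps of all sets computable in [A], so that no
   uniformity of the jump operator is needed. *)
pose Z A z := `[< exists2 C : nat -> bool, forall n, phi A (nfst z) n (C n) & jump (jump C) (nsnd z) >].
(* A set that [fireworks] does not escape is sent to itself as a default; [esc] shows that this
   never happens along [s]. *)
have /choice [next nextP] : forall A, exists B, escapes R A ->
    [/\ escapes R B, Tlt A B & comp (jump B) (fun z => Z A z)].
  move=> A; have [eA|nA] := pselect (escapes R A); last by exists A.
  by have [B BP] := escapes_extension (Z A) eA; exists B.
pose s i := iter i next (fun=> false).
have esc i : escapes R (s i).
  by elim: i => [|i IH]; [exact: escapes_empty|have [] := nextP _ IH].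
have sS i : Tlt (s i) (s i.+1) by have [] := nextP _ (esc i).
have refl A : Tle A A by apply/computable_inE; exact: comp_oracle.
have mono i k : i <= k -> Tle (s i) (s k).
  move=> /subnK <-; elim: (k - i) => // d IH.
  by apply: Tle_trans IH _; have [] := sS (d + i).
exists (fun A => exists i, Tle A (s i)); split; last first.
  move=> A [i /computable_inE Ai]; apply: escapes_not_ae_dominating => f fA.
  exact: esc i _ (comp_trans fA Ai).
split; first split.
- by exists (s 0); exists 0; exact: refl.
- by move=> X Y [i Xi] YX; exists i; exact: Tle_trans Xi.
- move=> X Y [i Xi] [k Yk]; exists (maxn i k); apply: Tle_join.
    exact: Tle_trans Xi (mono _ _ (leq_maxl _ _)).
  exact: Tle_trans Yk (mono _ _ (leq_maxr _ _)).
move=> A [i Ai]; exists (s i.+1); split; first by exists i.+1; exact: refl.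
- have [ss nss] := sS i; split; first exact: Tle_trans Ai ss.
  by move=> sA; apply: nss; exact: Tle_trans sA Ai.
(* The double jump of [A] is column [e] of [Z (s i)], where [e] is an index of [A] relative to
   [s i]. *)
- apply/computable_inE; have [_ _ hZ] := nextP _ (esc i); have [e eP] := Ai.
  apply: (@eq_comp _ (fun x => Z (s i) (npair e x))).
    move=> x; congr nat_of_bool; rewrite /Z !npairE.
    apply/asboolP/idP => [[C CP]|jx]; last by exists A.
    suff -> : A = C by [].
    apply/funext => n; have := phi_functional (eP n) (CP n).
    by case: (A n); case: (C n).
  by apply: (comp_comp hZ); apply: (comp_pair (comp_cst _ e)); exact: comp_id.
Qed.
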